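(* Let $G$ be an infinite finitely generated group and $S$ a finite generating set of $G$. Then the domino problem positive-reduces to the recurrent domino problem: $\mathrm{DP}(G,S)\leq_p \mathrm{RDP}(G,S)$.
   Context: For a finite alphabet $A$, a nearest neighbor pattern is a tuple $(a,b,s)$ with $a,b\in A$, $s\in S$; it appears in $x\in A^G$ if there is $g\in G$ with $x(g)=a$ and $x(gs)=b$. For a finite set $\mathcal F$ of nearest neighbor patterns, $X_{\mathcal F}\subseteq A^G$ is the set of configurations $x:G\to A$ in which no pattern of $\mathcal F$ appears. Domino problem $\mathrm{DP}(G,S)$: given a finite alphabet $A$ and a finite set $\mathcal F$ of nearest neighbor forbidden patterns, determine whether $X_{\mathcal F}$ is non-empty (yes instances are those with $X_{\mathcal F}\neq\emptyset$). Recurrent domino problem $\mathrm{RDP}(G,S)$: given a finite alphabet $A$, a finite set $\mathcal F$ of nearest neighbor forbidden patterns and a letter $a_0\in A$, determine whether there is $x\in X_{\mathcal F}$ such that $\{g\in G: x(g)=a_0\}$ is infinite. Decision problems are identified with the languages of (encodings of) their yes instances. For languages $L,L'$, $L\leq_p L'$ ($L$ positive-reduces to $L'$) means that for any input $w$ one can compute finitely many finite sets $F_1(w),\dots,F_n(w)$ such that $w\in L$ if and only if there is $i\in\{1,\dots,n\}$ with $F_i(w)\subseteq L'$. *)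

(* Defs.v *)
From HB Require Import structures.
From mathcomp Require Import all_boot finmap.
From mathcomp Require Import boolp classical_sets functions cardinality.

Set Implicit Arguments.
Unset Strict Implicit.
Unset Printing Implicit Defensive.

Local Open Scope classical_set_scope.

(* Kleene's mu-recursive function schemes, indexed by their arity. *)
Inductive recfun : nat -> Type :=
| Zero k : recfun k
| Succ : recfun 1
| Proj k (i : 'I_k) : recfun k
| Comp k m (f : recfun m) (gs : 'I_m -> recfun k) : recfun k
| Prec k (f : recfun k) (g : recfun k.+2) : recfun k.+1
| Mu k (f : recfun k.+1) : recfun k.

(* [eval e v y]: the partial function denoted by [e] is defined at [v], with
   value [y]. Primitive recursion is on the first argument, and its step takes
   the predecessor, the previous value and the remaining arguments;
   minimisation requires all values before the first zero to be defined. *)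
Fixpoint eval k (e : recfun k) : k.-tuple nat -> nat -> Prop :=
  match e in recfun k return k.-tuple nat -> nat -> Prop with
  | Zero _ => fun _ y => y = 0
  | Succ => fun v y => y = (thead v).+1
  | Proj _ i => fun v y => y = tnth v i
  | Comp _ m f gs => fun v y =>
      exists2 u : m.-tuple nat,
        forall i, eval (gs i) v (tnth u i) & eval f u y
  | Prec _ f g => fun v y =>
      (fix rec n : nat -> Prop :=
         if n is p.+1 then
           fun y => exists2 z, rec p z & eval g [tuple of p :: z :: behead v] y
         else eval f [tuple of behead v]) (thead v) y
  | Mu _ f => fun v y =>
      eval f [tuple of y :: v] 0 /\
      forall z, z < y -> exists t, eval f [tuple of z :: v] t.+1
  end.

(* Inputs and outputs are coded as numbers by [choice.pickle], which is the
   identity on [nat], while pairs and sequences are coded through the bijection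
   [CodeSeq.code : seq nat -> nat]. *)
Definition computable (T U : countType) (f : T -> U) : Prop :=
  exists e : recfun 1, forall x,
    eval e [tuple choice.pickle x] (choice.pickle (f x)).

(* Words are identified with the natural numbers that code them. *)
Definition language := set nat.

(* [f w] lists the finite sets F_1(w), ..., F_n(w), each given as a list. *)
Definition positive_reduces (L L' : language) : Prop :=
  exists2 f : nat -> seq (seq nat), computable f &
    forall w, L w <-> exists2 F, F \in f w & [set` F] `<=` L'.

(* [group_closed] is the library's "subgroup" condition; quantifying over
   boolean predicates is quantifying over all subsets, as the ambient logic is
   classical. *)
Definition generates (G : groupType) (S : {fset G}) : Prop :=
  forall H : {pred G}, group_closed H -> {subset S <= H} ->
    forall g : G, g \in H.

(* The alphabet is {0, ..., n-1}, as finite alphabets are given up to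
   renaming of their letters; [S] is here the finite type of its elements. *)
Definition pattern (G : groupType) (S : {fset G}) (n : nat) : finType :=
  ('I_n * 'I_n * S)%type.

Definition appears (G : groupType) (S : {fset G}) n
    (p : pattern S n) (x : G -> 'I_n) : Prop :=
  let: (a, b, s) := p in exists g : G, x g = a /\ x (g * val s)%g = b.

Record dp_instance (G : groupType) (S : {fset G}) := DPInstance {
  alphabet_size : nat;
  forbidden : seq (pattern S alphabet_size)
}.

Record rdp_instance (G : groupType) (S : {fset G}) := RDPInstance {
  rdp_dp : dp_instance S;
  letter : 'I_(alphabet_size rdp_dp)
}.

Definition configurations (G : groupType) (S : {fset G}) (I : dp_instance S) :
    set (G -> 'I_(alphabet_size I)) :=
  [set x | forall p, p \in forbidden I -> ~ appears p x].
Arguments configurations {G S} I.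

(* An element of [S] is coded by its index in the enumeration of [S]. *)
Definition encode_dp (G : groupType) (S : {fset G}) (I : dp_instance S) : nat :=
  choice.pickle (alphabet_size I,
    [seq (val p.1.1, val p.1.2, p.2) | p <- forbidden I]).

Definition encode_rdp (G : groupType) (S : {fset G}) (J : rdp_instance S) : nat :=
  choice.pickle (encode_dp (rdp_dp J), val (letter J)).

Definition DP (G : groupType) (S : {fset G}) : language :=
  [set encode_dp I | I in [set I : dp_instance S | configurations I !=set0]].

Definition RDP (G : groupType) (S : {fset G}) : language :=
  [set encode_rdp J | J in [set J : rdp_instance S |
     exists2 x, configurations (rdp_dp J) x &
        infinite_set [set g | x g = letter J]]].

(* Main.v *)
Require Import Defs.
From mathcomp Require Import all_boot finmap.
From mathcomp Require Import boolp classical_sets functions cardinality.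

(** As [G] is infinite and the alphabet finite, every configuration takes some
    letter infinitely often, so [I] is a yes instance of the domino problem iff
    [(I, a)] is a yes instance of the recurrent one for some letter [a].
    The reduction does not decode its input [w]: it lists the pairs [(w, a)]
    for all [a < w], since the number of letters of [I] is smaller than the
    code of [I], and pairs that code no instance are harmless. *)

Definition recursive k (F : k.-tuple nat -> nat) : Prop :=
  exists e : recfun k, forall v, eval e v (F v).

Lemma eq_recursive {k} {F : k.-tuple nat -> nat} F' :
  recursive k F -> F =1 F' -> recursive k F'.
Proof. by case=> e eP eqF; exists e => v; rewrite -eqF. Qed.

Lemma recursive0 k : recursive k (fun=> 0).
Proof. by exists (Zero k). Qed.

(** With [nth 0] arguments are indexed by plain numbers; past the arity the default value is 0,
    which [Zero] computes. *)
Lemma recursive_nth k i : recursive k (fun v => nth 0 v i).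
Proof.
have [ltik | leki] := ltnP i k.
  by exists (Proj (Ordinal ltik)) => v; rewrite /= (tnth_nth 0).
by exists (Zero k) => v; rewrite /= nth_default // size_tuple.
Qed.

Lemma recursive_succ k F : recursive k F -> recursive k (fun v => (F v).+1).
Proof.
case=> e eP; exists (Comp Succ (fun=> e)) => v /=.
by exists [tuple F v] => // i; rewrite ord1; apply: eP.
Qed.

Lemma recursive_comp2 {h k F G} :
    recursive 2 (fun v => h (nth 0 v 0) (nth 0 v 1)) ->
    recursive k F -> recursive k G ->
  recursive k (fun v => h (F v) (G v)).
Proof.
move=> [eh hP] [eF FP] [eG GP].
exists (Comp eh (fun i : 'I_2 => if val i == 0 then eF else eG)) => v /=.
exists [tuple F v; G v]; last exact: (hP [tuple F v; G v]).
by case=> [[|[|//]] lti]; rewrite (tnth_nth 0).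
Qed.

Lemma recursive_prec {h f g} :
    recursive 1 (fun v => f (nth 0 v 0)) ->
    recursive 3 (fun v => g (nth 0 v 0) (nth 0 v 1) (nth 0 v 2)) ->
    (forall y, h 0 y = f y) -> (forall n y, h n.+1 y = g n (h n y) y) ->
  recursive 2 (fun v => h (nth 0 v 0) (nth 0 v 1)).
Proof.
move=> [ef fP] [eg gP] h0 hS; exists (Prec ef eg) => v.
have -> : nth 0 v 0 = thead v by rewrite [thead v](tnth_nth 0).
rewrite -[nth 0 v 1]nth_behead /=.
elim: (thead v) => [|n IHn]; first by rewrite h0; apply: (fP [tuple of behead v]).
rewrite hS; exists (h n (nth 0 (behead v) 0)) => //.
Qed.

Lemma recursive_add k F G :
  recursive k F -> recursive k G -> recursive k (fun v => F v + G v).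
Proof.
apply: recursive_comp2; apply: (@recursive_prec addn id (fun _ z _ => z.+1)) => //.
  exact: recursive_nth.
exact/recursive_succ/recursive_nth.
Qed.

Lemma recursive_mul k F G :
  recursive k F -> recursive k G -> recursive k (fun v => F v * G v).
Proof.
apply: recursive_comp2.
apply: (@recursive_prec muln (fun=> 0) (fun _ z y => y + z)) => //.
  exact: recursive0.
by apply: recursive_add; apply: recursive_nth.
Qed.

Lemma recursive_exp2 k F : recursive k F -> recursive k (fun v => 2 ^ F v).
Proof.
(* A dummy second argument gives [2 ^ n] the binary form required by [recursive_prec]. *)
move=> rF; apply: (@recursive_comp2 (fun n _ => 2 ^ n)) (recursive0 k) => //.
apply: (@recursive_prec (fun n _ => 2 ^ n) (fun=> 1) (fun _ z _ => z + z)) => //.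
- exact/recursive_succ/recursive0.
- by apply: recursive_add; apply: recursive_nth.
- by move=> n _; rewrite expnS mul2n addnn.
Qed.

(** Prepending is arithmetic on codes: [CodeSeq.code (n :: s)] equals
    [2 ^ n * (CodeSeq.code s).*2.+1]. *)
Lemma recursive_cons k F (s : k.-tuple nat -> seq nat) :
    recursive k F -> recursive k (fun v => CodeSeq.code (s v)) ->
  recursive k (fun v => CodeSeq.code (F v :: s v)).
Proof.
move=> rF rs.
have rm := recursive_mul _ _ _ (recursive_exp2 _ _ rF)
  (recursive_succ _ _ (recursive_add _ _ _ rs rs)).
by apply: eq_recursive rm _ => v; rewrite addnn.
Qed.

(** The reversal makes the passage from [n] to [n.+1] prepend one entry, as suits a primitive
    recursion on codes. *)
Definition singleton_pairs (n w : nat) : seq (seq nat) :=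
  [seq [:: choice.pickle (w, a)] | a <- rev (iota 0 n)].

Lemma recursive_singleton_pairs :
  recursive 2 (fun v => choice.pickle (singleton_pairs (nth 0 v 0) (nth 0 v 1))).
Proof.
pose code_pair n w := CodeSeq.code [:: CodeSeq.code [:: w; n]].
apply: (@recursive_prec (fun n w => choice.pickle (singleton_pairs n w))
  (fun=> 0) (fun n z w => CodeSeq.code (code_pair n w :: CodeSeq.decode z))) => //.
- exact: recursive0.
- apply: recursive_cons.
    by do 4?[apply: recursive_cons | apply: recursive_nth | apply: recursive0].
  (* The tail's code is the previous value itself, since recoding cancels [CodeSeq.decode]. *)
  by apply: eq_recursive (recursive_nth _ 1) _ => v; rewrite CodeSeq.decodeK.
- move=> n w; rewrite /singleton_pairs -addn1 iotaD rev_cat /=.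
  by rewrite CodeSeq.codeK.
Qed.

Lemma computable_singleton_pairs : computable (fun w => singleton_pairs w w).
Proof.
have [e eP] := @recursive_comp2 (fun n w => choice.pickle (singleton_pairs n w))
  _ _ _ recursive_singleton_pairs (recursive_nth 1 0) (recursive_nth 1 0).
by exists e => w; apply: eP.
Qed.

(** A pair is coded as a two-entry sequence, and the code of a sequence exceeds each of its
    entries. *)
Lemma alphabet_size_lt (G : groupType) (S : {fset G}) (I : dp_instance S) :
  alphabet_size I < encode_dp I.
Proof.
by have /andP[] := CodeSeq.ltn_code
  [:: alphabet_size I;
      choice.pickle [seq (val p.1.1, val p.1.2, p.2) | p <- forbidden I]].
Qed.

(** Pigeonhole: if all fibers were finite, their finite union [T] would be finite. *)
Lemma infinite_fiber (T : Type) (A : finType) (x : T -> A) :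
  infinite_set [set: T]%classic ->
  exists a, infinite_set [set t | x t = a]%classic.
Proof.
move=> infT; apply: contrapT => /forallNP finx; apply: infT.
have -> : [set: T]%classic = (\bigcup_a [set t | x t = a])%classic.
  by apply/seteqP; split=> // t _; exists (x t).
by apply: bigcup_finite => [|a _]; [exact: finite_finset | exact: contrapT (finx a)].
Qed.

Theorem lemma8 (G : groupType) (S : {fset G}) :
  infinite_set [set: G]%classic -> generates S ->
  positive_reduces (DP S) (RDP S).
Proof.
move=> infG _; exists (fun w => singleton_pairs w w).
  exact: computable_singleton_pairs.
move=> w; split=> [[I [x xI] <-] | [_ /mapP[a _ ->] sub]].
  have [a infa] := infinite_fiber _ _ x infG.
  exists [:: choice.pickle (encode_dp I, val a)].
    apply/mapP; exists (val a) => //.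
    by rewrite mem_rev mem_iota (ltn_trans (ltn_ord a) (alphabet_size_lt _ _ I)).
  move=> u /=; rewrite inE => /eqP ->.
  by exists (RDPInstance a) => //; exists x.
(* The pair [(w, a)] has the same code as some yes instance [J]; by injectivity [w] codes the domino
   part of [J], and the configuration found for [J] witnesses [DP]. *)
have [J [x xJ _] eqJ] : RDP S (choice.pickle (w, a)) by apply: sub; rewrite /= inE.
have [<- _] := pcan_inj choice.pickleK eqJ.
by exists (rdp_dp J) => //; exists x.
Qed.
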